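(* Let be given: - a quantum stochastic process (the hidden process) $(\mathcal A_H,P_H,(\mathcal B_{H_n})_{n\in\mathbb N},(j_{H_n})_{n\in\mathbb N})$, where $\mathcal A_H=\bigotimes_{n\in\mathbb N}\mathcal B_{H_n}$, $P_H$ is a state on $\mathcal A_H$ and the $j_{H_n}$ are the tensor embeddings; - a family of $*$-algebras $(\mathcal B_{O_n})_{n\in\mathbb N}$; - a family of emission operators (completely positive identity preserving maps) $\mathcal E_{O,H,n}:\mathcal B_{H_n}\otimes\mathcal B_{O_n}\to\mathcal B_{H_n}$, $n\in\mathbb N$, and the associated global emission operator $\mathcal E_{O,H}=\bigotimes_{n\in\mathbb N}\mathcal E_{O,H,n}:\mathcal A_{H,O}\to\mathcal A_H$. Then there exists a quantum stochastic process, unique up to stochastic equivalence, $$(\mathcal A_{H,O},P_{H,O},(\mathcal B_{H_n}\otimes\mathcal B_{O_n})_{n\in\mathbb N},(j_{H_n}\otimes j_{O_n})_{n\in\mathbb N})$$ such that $\mathcal A_{H,O}=\bigotimes_{n\in\mathbb N}(\mathcal B_{H_n}\otimes\mathcal B_{O_n})$, the $j_{H_n}\otimes j_{O_n}$ are the tensor embeddings, and $P_{H,O}=P_H\circ\mathcal E_{O,H}$, i.e. $$P_{H,O}\Bigl(\bigotimes_{m=0}^nj_{H_m}(g_m)\otimes j_{O_m}(f_m)\Bigr)=P_H\Bigl(\bigotimes_{m=0}^nj_{H_m}\bigl(\mathcal E_{O,H,m}(g_m\otimes f_m)\bigr)\Bigr)$$ for all $n\in\mathbb N$, $f_m\in\mathcal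 B_{O_m}$ and $g_m\in\mathcal B_{H_m}$, $m\in\{0,\dots,n\}$.
   Context: All $*$-algebras are unital and tensor products are algebraic; an infinite tensor product is the union of the finite ones with units in the remaining factors, and the tensor embedding $j_n$ sends an element of the $n$-th factor to its tensor product with the units of the other factors. A state is a positive normalized linear functional. A quantum stochastic process is a quadruple consisting of a $*$-algebra $\mathcal A$ (sample algebra), a state on it, a family of $*$-algebras $\mathcal B_n$ (state algebras) and $*$-homomorphisms $j_n:\mathcal B_n\to\mathcal A$; two such processes with the same state algebras are stochastically equivalent if their joint expectations coincide. A linear map $\mathcal E$ between $*$-algebras is completely positive if for all $a_1,\dots,a_k$ the matrix $(\mathcal E(a_i^*a_j))_{i,j}$ is positive, i.e. a finite sum of matrices of the form $(c_i^*c_j)_{i,j}$ (for $C^*$-algebras this is the usual notion). *)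

(* Defs.v *)
From HB Require Import structures.
From mathcomp Require Import all_boot all_order all_algebra.
From mathcomp Require Import generic_quotient boolp classical_sets.

Set Implicit Arguments.
Unset Strict Implicit.
Unset Printing Implicit Defensive.

Import Order.TTheory GRing.Theory Num.Theory.
Local Open Scope ring_scope.
Local Open Scope quotient_scope.

(* Like algType, starAlgType excludes the zero algebra. *)
HB.mixin Record isStarAlgebra (C : numClosedFieldType) A of GRing.Algebra C A := {
  star : A -> A;
  starK : involutive star;
  starD : {morph star : x y / x + y};
  starM : forall x y : A, star (x * y) = star y * star x;
  starZ : forall (k : C) (x : A), star (k *: x) = k^* *: star x
}.

#[short(type="starAlgType")]
HB.structure Definition StarAlgebra (C : numClosedFieldType) :=
  {A of isStarAlgebra C A & GRing.Algebra C A}.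

HB.mixin Record isStarMorphism (C : numClosedFieldType) (A B : starAlgType C)
    (f : A -> B) := {
  star_morph : {morph f : x / star x}
}.

#[short(type="starHom")]
HB.structure Definition StarHom (C : numClosedFieldType) (A B : starAlgType C) :=
  {f of isStarMorphism C A B f & @GRing.LRMorphism C A B *:%R f}.

Section StarAlgebraTheory.
Variables (C : numClosedFieldType) (A : starAlgType C).

Lemma star1 : star (1 : A) = 1.
Proof. by rewrite -[LHS]mulr1 -{2}[1](starK (1 : A)) -starM mulr1 starK. Qed.

(* A complement of the line spanned by 1, given by Zorn's lemma, makes the unit
   take the value 1 under a linear functional; this is what shows that tensor
   products of nonzero algebras are nonzero. *)
Lemma unit_functional : exists phi : A -> C,
  [/\ forall x y, phi (x + y) = phi x + phi y,
      forall k x, phi (k *: x) = k * phi x & phi 1 = 1].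
Proof.
pose P (W : set A) :=
  (forall k x y, W x -> W y -> W (k *: x + y)) /\ ~ W 1.
have [F FP Ftot|M [[Mlin M1] Mmax]] := @Zorn_bigcup A P.
  split=> [k x y [X FX Xx] [Y FY Yy]|[X FX X1]]; last exact: (FP X FX).2.
  have [XY|YX] := Ftot X Y FX FY.
    by exists Y => //; apply: (FP Y FY).1 => //; apply: XY.
  by exists X => //; apply: (FP X FX).1 => //; apply: YX.
have M0 : M 0.
  apply: contrapT => nM0; apply: (Mmax (fun x => M x \/ x = 0)).
    by split=> [x Mx|sM]; [left|apply: nM0; apply: sM; right].
  split=> [k x y [Mx|->] [My|->]|[//|/eqP]]; last by rewrite oner_eq0.
  - by left; apply: Mlin.
  - have [->|k0] := eqVneq k 0; first by rewrite scale0r addr0; right.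
    case: nM0; rewrite -(addNr x) -scaleN1r; exact: Mlin.
  - by rewrite scaler0 add0r; left.
  - by rewrite scaler0 addr0; right.
have MZ k x : M x -> M (k *: x) by move=> Mx; rewrite -[_ *: _]addr0; apply: Mlin.
have MD x y : M x -> M y -> M (x + y).
  by move=> Mx My; rewrite -[x]scale1r; apply: Mlin.
have dec x : exists c : C, M (x - c *: 1).
  have [Mx|nMx] := pselect (M x); first by exists 0; rewrite scale0r subr0.
  apply: contrapT => ndec.
  apply: (Mmax (fun z => exists k m, M m /\ z = k *: x + m)).
    split=> [z Mz|sM]; first by exists 0, z; rewrite scale0r add0r.
    by apply/nMx/sM; exists 1, 0; rewrite scale1r addr0.
  split=> [k _ _ [h [m [Mm ->]]] [h' [m' [Mm' ->]]]|[k [m [Mm e1]]]].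
    exists (k * h + h'), (k *: m + m'); split; first exact: Mlin.
    by rewrite scalerDr scalerDl scalerA addrACA.
  have [k0|k0] := eqVneq k 0.
    by apply: M1; rewrite e1 k0 scale0r add0r.
  apply: ndec; exists k^-1; rewrite e1 scalerDr scalerA mulVf // scale1r.
  by rewrite opprD addrA subrr add0r -scaleNr; apply: MZ.
have uniq x c c' : M (x - c *: 1) -> M (x - c' *: 1) -> c = c'.
  move=> Mc Mc'; apply: contrapT => /eqP; rewrite -subr_eq0 => ncc.
  apply: M1; have -> : 1 = (c - c')^-1 *: ((-1) *: (x - c *: 1) + (x - c' *: 1)) :> A.
    rewrite scaleN1r opprB addrA subrK -scalerBl scalerA mulVf //.
    by rewrite scale1r.
  exact/MZ/Mlin.
have [phi phiP] := choice dec; exists phi; split=> [x y|k x|].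
- apply: (uniq (x + y)) => //.
  by rewrite scalerDl opprD addrACA; apply: MD.
- by apply: (uniq (k *: x)) => //; rewrite -scalerA -scalerBr; apply: MZ.
- by apply: (uniq 1) => //; rewrite scale1r subrr.
Qed.

End StarAlgebraTheory.

Section StarHomTheory.
Variables (C : numClosedFieldType) (A B D : starAlgType C).
Variables (f : starHom B D) (g : starHom A B).

Fact id_star : {morph (@idfun A) : x / star x}.
Proof. by []. Qed.

HB.instance Definition _ := isStarMorphism.Build C A A (@idfun A) id_star.

Fact comp_star : {morph f \o g : x / star x}.
Proof. by move=> x; rewrite /= !star_morph. Qed.

HB.instance Definition _ := isStarMorphism.Build C A D (f \o g) comp_star.
End StarHomTheory.

Section Tensor.
Variables (C : numClosedFieldType) (A B : starAlgType C).

(* A list [:: (a1, b1); ...; (ak, bk)] stands for the formal sum of the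
   symbols (ai, bi); tens_rel is the congruence generated by the bilinearity
   relations. *)
Inductive tens_rel : seq (A * B) -> seq (A * B) -> Prop :=
| tens_refl s : tens_rel s s
| tens_sym s t : tens_rel s t -> tens_rel t s
| tens_trans s t u : tens_rel s t -> tens_rel t u -> tens_rel s u
| tens_cat s s' t t' :
    tens_rel s s' -> tens_rel t t' -> tens_rel (s ++ t) (s' ++ t')
| tens_catC s t : tens_rel (s ++ t) (t ++ s)
| tens_addl a a' b : tens_rel [:: (a + a', b)] [:: (a, b); (a', b)]
| tens_addr a b b' : tens_rel [:: (a, b + b')] [:: (a, b); (a, b')]
| tens_scale (k : C) a b : tens_rel [:: (k *: a, b)] [:: (a, k *: b)]
| tens_zero b : tens_rel [:: (0, b)] [::].

Definition tens_eq (s t : seq (A * B)) : bool := `[< tens_rel s t >].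

Fact tens_eq_refl : reflexive tens_eq.
Proof. by move=> s; apply/asboolP/tens_refl. Qed.

Fact tens_eq_sym : symmetric tens_eq.
Proof.
by move=> s t; apply/asboolP/asboolP; apply: tens_sym.
Qed.

Fact tens_eq_trans : transitive tens_eq.
Proof.
move=> t s u /asboolP st /asboolP tu; apply/asboolP; exact: tens_trans tu.
Qed.

Canonical tens_equiv := EquivRel tens_eq tens_eq_refl tens_eq_sym tens_eq_trans.

Definition tensor : Type := {eq_quot tens_equiv}.
HB.instance Definition _ := Choice.on tensor.
HB.instance Definition _ := Quotient.on tensor.

Lemma tensorW (K : tensor -> Prop) :
  (forall s, K (\pi_tensor s)) -> forall x, K x.
Proof. by move=> Ks x; rewrite -[x]reprK; apply: Ks. Qed.

Lemma pi_tensP (s t : seq (A * B)) :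
  \pi_tensor s = \pi_tensor t <-> tens_rel s t.
Proof.
by split=> [/eqquotP/asboolP|st] //; apply/eqquotP/asboolP.
Qed.

Lemma tens_repr (s : seq (A * B)) : tens_rel (repr (\pi_tensor s)) s.
Proof. by apply/pi_tensP; rewrite reprK. Qed.

Definition tens (a : A) (b : B) : tensor := \pi_tensor [:: (a, b)].

Definition tens_scale_seq (k : C) (s : seq (A * B)) :=
  [seq (k *: p.1, p.2) | p <- s].

Lemma tens_scale_seqP k s t :
  tens_rel s t -> tens_rel (tens_scale_seq k s) (tens_scale_seq k t).
Proof.
elim=> {s t} [s|s t _|s t u _ IH1 _|s s' t t' _ IH1 _ IH2|s t|a a' b|a b b'|h a b|b].
- exact: tens_refl.
- exact: tens_sym.
- exact: tens_trans.
- by rewrite /tens_scale_seq !map_cat; apply: tens_cat.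
- by rewrite /tens_scale_seq !map_cat; apply: tens_catC.
- by rewrite /= scalerDr; apply: tens_addl.
- exact: tens_addr.
- by rewrite /= scalerA mulrC -scalerA; apply: tens_scale.
- by rewrite /= scaler0; apply: tens_zero.
Qed.

Definition tensor_zero : tensor := \pi_tensor [::].
Definition tensor_add (x y : tensor) : tensor := \pi_tensor (repr x ++ repr y).
Definition tensor_scale (k : C) (x : tensor) : tensor :=
  \pi_tensor (tens_scale_seq k (repr x)).
Definition tensor_opp (x : tensor) : tensor := tensor_scale (-1) x.

Lemma tensor_addE s t :
  tensor_add (\pi_tensor s) (\pi_tensor t) = \pi_tensor (s ++ t).
Proof. by apply/pi_tensP/tens_cat; apply: tens_repr. Qed.

Lemma tensor_scaleE k s :
  tensor_scale k (\pi_tensor s) = \pi_tensor (tens_scale_seq k s).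
Proof. by apply/pi_tensP/tens_scale_seqP/tens_repr. Qed.

Fact tensor_addA : associative tensor_add.
Proof.
move=> x y z; elim/tensorW: x => s; elim/tensorW: y => t; elim/tensorW: z => u.
by rewrite !tensor_addE catA.
Qed.

Fact tensor_addC : commutative tensor_add.
Proof.
move=> x y; elim/tensorW: x => s; elim/tensorW: y => t; rewrite !tensor_addE.
exact/pi_tensP/tens_catC.
Qed.

Fact tensor_add0 : left_id tensor_zero tensor_add.
Proof. by move=> x; elim/tensorW: x => s; rewrite tensor_addE. Qed.

Lemma tens_scale_seqD h k s :
  tens_rel (tens_scale_seq (h + k) s) (tens_scale_seq h s ++ tens_scale_seq k s).
Proof.
elim: s => [|[a b] s IHs] /=; first exact: tens_refl.
rewrite scalerDl; set S := tens_scale_seq h s; set K := tens_scale_seq k s.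
apply: tens_trans (tens_cat (tens_addl _ _ _) IHs) _.
rewrite -[X in tens_rel X]/([:: (h *: a, b)] ++ (([:: (k *: a, b)] ++ S) ++ K)).
rewrite -[X in tens_rel _ X]/([:: (h *: a, b)] ++ (S ++ ([:: (k *: a, b)] ++ K))).
apply: tens_cat; first exact: tens_refl.
rewrite [X in tens_rel _ X]catA; apply: tens_cat; last exact: tens_refl.
exact: tens_catC.
Qed.

Lemma tens_scale_seq0 s : tens_rel (tens_scale_seq 0 s) [::].
Proof.
elim: s => [|[a b] s IHs] /=; first exact: tens_refl.
by rewrite scale0r -cat1s -[[::]]cats0; apply: tens_cat IHs; apply: tens_zero.
Qed.

Lemma tens_scale_seq1 s : tens_scale_seq 1 s = s.
Proof. by elim: s => [|[a b] s IHs] //=; rewrite scale1r IHs. Qed.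

Fact tensor_addN : left_inverse tensor_zero tensor_opp tensor_add.
Proof.
move=> x; elim/tensorW: x => s; rewrite /tensor_opp tensor_scaleE tensor_addE.
apply/pi_tensP; rewrite -{2}(tens_scale_seq1 s).
apply: tens_trans (tens_sym (tens_scale_seqD _ _ _)) _.
by rewrite addNr; apply: tens_scale_seq0.
Qed.

HB.instance Definition _ := GRing.isZmodule.Build tensor
  tensor_addA tensor_addC tensor_add0 tensor_addN.

Lemma pi_tens_cat s t : \pi_tensor (s ++ t) = \pi_tensor s + \pi_tensor t.
Proof. by rewrite -tensor_addE. Qed.

Fact tensor_scaleA h k v :
  tensor_scale h (tensor_scale k v) = tensor_scale (h * k) v.
Proof.
elim/tensorW: v => s; rewrite !tensor_scaleE; congr (\pi_tensor _).
by elim: s => [|[a b] s IHs] //=; rewrite scalerA IHs.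
Qed.

Fact tensor_scale1 : left_id 1 tensor_scale.
Proof. by move=> x; elim/tensorW: x => s; rewrite tensor_scaleE tens_scale_seq1. Qed.

Fact tensor_scaleDr : right_distributive tensor_scale +%R.
Proof.
move=> k x y; elim/tensorW: x => s; elim/tensorW: y => t.
by rewrite -pi_tens_cat !tensor_scaleE /tens_scale_seq map_cat pi_tens_cat.
Qed.

Fact tensor_scaleDl v : {morph tensor_scale^~ v : h k / h + k}.
Proof.
elim/tensorW: v => s h k; rewrite !tensor_scaleE -pi_tens_cat.
exact/pi_tensP/tens_scale_seqD.
Qed.

HB.instance Definition _ := GRing.Zmodule_isLmodule.Build C tensor
  tensor_scaleA tensor_scale1 tensor_scaleDr tensor_scaleDl.

Lemma tensDl a a' b : tens (a + a') b = tens a b + tens a' b.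
Proof. by rewrite /tens -pi_tens_cat; apply/pi_tensP/tens_addl. Qed.

Lemma tensDr a b b' : tens a (b + b') = tens a b + tens a b'.
Proof. by rewrite /tens -pi_tens_cat; apply/pi_tensP/tens_addr. Qed.

Lemma tensZl k a b : tens (k *: a) b = k *: tens a b.
Proof. by rewrite /tens [RHS]tensor_scaleE. Qed.

Lemma tensZr k a b : tens a (k *: b) = k *: tens a b.
Proof. by rewrite -tensZl; apply/pi_tensP/tens_sym/tens_scale. Qed.

Lemma pi_tens_sum s : \pi_tensor s = \sum_(p <- s) tens p.1 p.2.
Proof.
elim: s => [|[a b] s IHs]; first by rewrite big_nil.
by rewrite big_cons -cat1s pi_tens_cat IHs.
Qed.

Lemma tensor_ind (K : tensor -> Prop) :
  (forall a b, K (tens a b)) -> K 0 -> (forall x y, K x -> K y -> K (x + y)) ->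
  forall x, K x.
Proof.
move=> Kt K0 KD x; elim/tensorW: x => s; rewrite pi_tens_sum.
by apply: big_ind => // p _; apply: Kt.
Qed.

(* Balanced biadditive maps factor through the tensor product. *)
Section Lift.
Variables (V : zmodType) (f : A -> B -> V).

Definition tens_balanced :=
  [/\ forall a a' b, f (a + a') b = f a b + f a' b,
      forall a b b', f a (b + b') = f a b + f a b'
    & forall (k : C) a b, f (k *: a) b = f a (k *: b)].

Definition tens_lift (x : tensor) : V := \sum_(p <- repr x) f p.1 p.2.

Hypothesis fP : tens_balanced.

Lemma tens_rel_sum s t :
  tens_rel s t -> \sum_(p <- s) f p.1 p.2 = \sum_(p <- t) f p.1 p.2.
Proof.
case: fP => fDl fDr fZ.
elim=> {s t} [s|s t _|s t u _ -> _|s s' t t' _ IH1 _ IH2|s t|a a' b|a b b'|h a b|b].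
- by [].
- exact: esym.
- by [].
- by rewrite !big_cat /= IH1 IH2.
- by rewrite !big_cat /= addrC.
- by rewrite !big_cons !big_nil !addr0 /= fDl.
- by rewrite !big_cons !big_nil !addr0 /= fDr.
- by rewrite !big_cons !big_nil !addr0 /= fZ.
- rewrite big_cons !big_nil addr0 /=; apply: (addIr (f 0 b)).
  by rewrite -fDl !add0r.
Qed.

Lemma tens_lift_pi s : tens_lift (\pi_tensor s) = \sum_(p <- s) f p.1 p.2.
Proof. by apply: tens_rel_sum; apply: tens_repr. Qed.

Lemma tens_liftE a b : tens_lift (tens a b) = f a b.
Proof. by rewrite tens_lift_pi big_cons big_nil addr0. Qed.

Lemma tens_liftD : {morph tens_lift : x y / x + y}.
Proof.
move=> x y; elim/tensorW: x => s; elim/tensorW: y => t.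
by rewrite -pi_tens_cat !tens_lift_pi big_cat.
Qed.

Lemma tens_lift0 : tens_lift 0 = 0.
Proof. by apply: (addIr (tens_lift 0)); rewrite -tens_liftD !add0r. Qed.
End Lift.

Lemma tens_lift_linear (V : lmodType C) (f : A -> B -> V) :
  tens_balanced f -> (forall k a b, f (k *: a) b = k *: f a b) ->
  linear (tens_lift f).
Proof.
move=> fP fZ k x y; rewrite tens_liftD //; congr (_ + _).
elim/tensor_ind: x => [a b||x x' IH IH']; last 1 first.
- by rewrite scalerDr !tens_liftD // IH IH' scalerDr.
- by rewrite -tensZl !tens_liftE.
- by rewrite scaler0 tens_lift0 // scaler0.
Qed.

Definition tensor_one : tensor := tens 1 1.

Definition tens_mulf (y : tensor) (a : A) (b : B) : tensor :=
  tens_lift (fun a' b' => tens (a * a') (b * b')) y.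

Definition tensor_mul (x y : tensor) : tensor := tens_lift (tens_mulf y) x.

Definition tensor_star (x : tensor) : tensor :=
  tens_lift (fun a b => tens (star a) (star b)) x.

Fact tens_mulf_balanced2 a b :
  tens_balanced (fun a' b' => tens (a * a') (b * b')).
Proof.
split=> [a1 a2 b1|a1 b1 b2|k a1 b1].
- by rewrite mulrDr tensDl.
- by rewrite mulrDr tensDr.
- by rewrite -!scalerAr tensZl tensZr.
Qed.

Lemma tens_mulf_tens a b a' b' :
  tens_mulf (tens a' b') a b = tens (a * a') (b * b').
Proof. by rewrite /tens_mulf tens_liftE //; apply: tens_mulf_balanced2. Qed.

Lemma tens_mulfD x y a b : tens_mulf (x + y) a b = tens_mulf x a b + tens_mulf y a b.
Proof. by rewrite /tens_mulf tens_liftD //; apply: tens_mulf_balanced2. Qed.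

Lemma tens_mulf0 a b : tens_mulf 0 a b = 0.
Proof. by rewrite /tens_mulf tens_lift0 //; apply: tens_mulf_balanced2. Qed.

Fact tens_mulf_balanced y : tens_balanced (tens_mulf y).
Proof.
elim/tensor_ind: y => [a' b'||x y [x1 x2 x3] [y1 y2 y3]].
- split=> [a1 a2 b1|a1 b1 b2|k a1 b1]; rewrite !tens_mulf_tens.
  + by rewrite mulrDl tensDl.
  + by rewrite mulrDl tensDr.
  + by rewrite -!scalerAl tensZl tensZr.
- by split=> *; rewrite !tens_mulf0 // addr0.
- split=> *; rewrite !tens_mulfD.
  + by rewrite x1 y1 addrACA.
  + by rewrite x2 y2 addrACA.
  + by rewrite x3 y3.
Qed.

Lemma tensor_mulE a b a' b' :
  tensor_mul (tens a b) (tens a' b') = tens (a * a') (b * b').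
Proof.
by rewrite /tensor_mul tens_liftE ?tens_mulf_tens //; apply: tens_mulf_balanced.
Qed.

Fact tensor_mulDl : left_distributive tensor_mul +%R.
Proof. by move=> x y z; apply: tens_liftD; apply: tens_mulf_balanced. Qed.

Lemma tensor_mul0l y : tensor_mul 0 y = 0.
Proof. by apply: tens_lift0; apply: tens_mulf_balanced. Qed.

Fact tensor_mulDr : right_distributive tensor_mul +%R.
Proof.
move=> x y z; elim/tensor_ind: x => [a b||x x' IH IH'].
- by rewrite /tensor_mul !tens_liftE ?tens_mulfD //; apply: tens_mulf_balanced.
- by rewrite !tensor_mul0l addr0.
- by rewrite !tensor_mulDl IH IH' addrACA.
Qed.

Lemma tensor_mul0r x : tensor_mul x 0 = 0.
Proof.
by apply: (addIr (tensor_mul x 0)); rewrite -tensor_mulDr !add0r.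
Qed.

Fact tensor_mul1l : left_id tensor_one tensor_mul.
Proof.
move=> z; elim/tensor_ind: z => [a b||x y IH IH']; last by rewrite tensor_mulDr IH IH'.
  by rewrite tensor_mulE !mul1r.
exact: tensor_mul0r.
Qed.

Fact tensor_mul1r : right_id tensor_one tensor_mul.
Proof.
move=> z; elim/tensor_ind: z => [a b||x y IH IH']; last by rewrite tensor_mulDl IH IH'.
  by rewrite tensor_mulE !mulr1.
exact: tensor_mul0l.
Qed.

Fact tensor_mulA : associative tensor_mul.
Proof.
move=> x y z; elim/tensor_ind: x => [a b||x x' IH IH']; last 1 first.
- by rewrite !tensor_mulDl IH IH'.
- elim/tensor_ind: y => [a' b'||y y' IH IH']; last 1 first.
  + by rewrite tensor_mulDl !tensor_mulDr tensor_mulDl IH IH'.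
  + elim/tensor_ind: z => [a2 b2||z z' IH IH']; last 1 first.
    * by rewrite !tensor_mulDr IH IH'.
    * by rewrite !tensor_mulE !mulrA.
    * by rewrite !tensor_mul0r.
  + by rewrite tensor_mul0l tensor_mul0r tensor_mul0l.
- by rewrite !tensor_mul0l.
Qed.

Fact tensor_one_neq0 : tensor_one != 0.
Proof.
have [phi [phiD phiZ phi1]] := unit_functional B.
have bal : tens_balanced (fun a b => phi b *: a).
  split=> [a a' b|a b b'|k a b]; first by rewrite scalerDr.
    by rewrite phiD scalerDl.
  by rewrite phiZ scalerA mulrC.
apply/eqP => /(congr1 (tens_lift (fun a b => phi b *: a))).
rewrite tens_lift0 // tens_liftE // phi1 scale1r => /eqP.
by rewrite oner_eq0.
Qed.

HB.instance Definition _ := GRing.Zmodule_isNzRing.Build tensor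
  tensor_mulA tensor_mul1l tensor_mul1r tensor_mulDl tensor_mulDr
  tensor_one_neq0.

Lemma tensM a b a' b' : tens a b * tens a' b' = tens (a * a') (b * b').
Proof. exact: tensor_mulE. Qed.

Lemma tens11 : tens 1 1 = 1.
Proof. by []. Qed.

Fact tensor_scalerAl (k : C) (x y : tensor) : k *: (x * y) = (k *: x) * y.
Proof.
elim/tensor_ind: x => [a b||x x' IH IH']; last 1 first.
- by rewrite mulrDl !scalerDr mulrDl IH IH'.
- elim/tensor_ind: y => [a' b'||y y' IH IH']; last 1 first.
  + by rewrite !mulrDr scalerDr IH IH'.
  + by rewrite tensM -!tensZl tensM scalerAl.
  + by rewrite !mulr0 scaler0.
- by rewrite scaler0 !mul0r scaler0.
Qed.

Fact tensor_scalerAr (k : C) (x y : tensor) : k *: (x * y) = x * (k *: y).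
Proof.
elim/tensor_ind: x => [a b||x x' IH IH']; last 1 first.
- by rewrite !mulrDl !scalerDr IH IH'.
- elim/tensor_ind: y => [a' b'||y y' IH IH']; last 1 first.
  + by rewrite mulrDr !scalerDr mulrDr IH IH'.
  + by rewrite tensM -!tensZl tensM scalerAr.
  + by rewrite scaler0 !mulr0 scaler0.
- by rewrite !mul0r scaler0.
Qed.

HB.instance Definition _ := GRing.Lmodule_isLalgebra.Build C tensor tensor_scalerAl.
HB.instance Definition _ := GRing.Lalgebra_isAlgebra.Build C tensor tensor_scalerAr.

Fact tensor_star_balanced : tens_balanced (fun a b => tens (star a) (star b)).
Proof.
by split=> *; rewrite ?starD ?starZ ?tensDl ?tensDr ?tensZl ?tensZr.
Qed.

Lemma tensor_starE a b : tensor_star (tens a b) = tens (star a) (star b).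
Proof. by apply: tens_liftE; apply: tensor_star_balanced. Qed.

Fact tensor_starD : {morph tensor_star : x y / x + y}.
Proof. by apply: tens_liftD; apply: tensor_star_balanced. Qed.

Lemma tensor_star0 : tensor_star 0 = 0.
Proof. by apply: tens_lift0; apply: tensor_star_balanced. Qed.

Fact tensor_starK : involutive tensor_star.
Proof.
move=> z; elim/tensor_ind: z => [a b||x y IH IH']; last by rewrite !tensor_starD IH IH'.
  by rewrite !tensor_starE !starK.
by rewrite !tensor_star0.
Qed.

Fact tensor_starM x y : tensor_star (x * y) = tensor_star y * tensor_star x.
Proof.
elim/tensor_ind: x => [a b||x x' IH IH']; last 1 first.
- by rewrite mulrDl !tensor_starD mulrDr IH IH'.
- elim/tensor_ind: y => [a' b'||y y' IH IH']; last 1 first.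
  + by rewrite mulrDr !tensor_starD mulrDl IH IH'.
  + by rewrite tensM !tensor_starE tensM !starM.
  + by rewrite mulr0 tensor_star0 mul0r.
- by rewrite mul0r tensor_star0 mulr0.
Qed.

Fact tensor_starZ (k : C) x : tensor_star (k *: x) = k^* *: tensor_star x.
Proof.
elim/tensor_ind: x => [a b||x y IH IH'].
- by rewrite -tensZl !tensor_starE starZ tensZl.
- by rewrite scaler0 tensor_star0 scaler0.
- by rewrite scalerDr !tensor_starD IH IH' scalerDr.
Qed.

HB.instance Definition _ := isStarAlgebra.Build C tensor
  tensor_starK tensor_starD tensor_starM
  tensor_starZ.

Lemma star_tens a b : star (tens a b) = tens (star a) (star b).
Proof. exact: tensor_starE. Qed.

Lemma tens0l b : tens 0 b = 0.
Proof. by rewrite -[0 in LHS](scale0r (0 : A)) tensZl scale0r. Qed.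

Lemma tens0r a : tens a 0 = 0.
Proof. by rewrite -[0 in LHS](scale0r (0 : B)) tensZr scale0r. Qed.

Definition tens_l (a : A) : tensor := tens a 1.
Definition tens_r (b : B) : tensor := tens 1 b.

Fact tens_l_linear : linear tens_l.
Proof. by move=> k a a'; rewrite /tens_l tensDl tensZl. Qed.
Fact tens_l_monoid : monoid_morphism tens_l.
Proof. by split=> // a a'; rewrite /tens_l tensM mulr1. Qed.
Fact tens_l_star : {morph tens_l : x / star x}.
Proof. by move=> a; rewrite /tens_l star_tens star1. Qed.
HB.instance Definition _ := GRing.isLinear.Build C A tensor *:%R tens_l tens_l_linear.
HB.instance Definition _ := GRing.isMonoidMorphism.Build A tensor tens_l tens_l_monoid.
HB.instance Definition _ := isStarMorphism.Build C A tensor tens_l tens_l_star.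

Fact tens_r_linear : linear tens_r.
Proof. by move=> k a a'; rewrite /tens_r tensDr tensZr. Qed.
Fact tens_r_monoid : monoid_morphism tens_r.
Proof. by split=> // a a'; rewrite /tens_r tensM mulr1. Qed.
Fact tens_r_star : {morph tens_r : x / star x}.
Proof. by move=> a; rewrite /tens_r star_tens star1. Qed.
HB.instance Definition _ := GRing.isLinear.Build C B tensor *:%R tens_r tens_r_linear.
HB.instance Definition _ := GRing.isMonoidMorphism.Build B tensor tens_r tens_r_monoid.
HB.instance Definition _ := isStarMorphism.Build C B tensor tens_r tens_r_star.

End Tensor.

Notation "A ⊗ B" := (tensor A B) (at level 40, left associativity) : type_scope.
Notation "a ⊗ b" := (tens a b) (at level 40, left associativity) : ring_scope.

Section TensorMap.
Variables (C : numClosedFieldType) (A A' B B' : starAlgType C).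
Variables (f : {linear A -> A'}) (g : {linear B -> B'}).

Definition tensor_map : tensor A B -> tensor A' B' :=
  tens_lift (fun a b => tens (f a) (g b)).

Fact tensor_map_balanced : tens_balanced (fun a b => tens (f a) (g b)).
Proof.
by split=> *; rewrite ?linearD ?linearZ ?tensDl ?tensDr ?tensZl ?tensZr.
Qed.

Lemma tensor_mapE a b : tensor_map (tens a b) = tens (f a) (g b).
Proof. by apply: tens_liftE; apply: tensor_map_balanced. Qed.

Fact tensor_map_linear : linear tensor_map.
Proof.
apply: tens_lift_linear; first exact: tensor_map_balanced.
by move=> k a b; rewrite linearZ tensZl.
Qed.

HB.instance Definition _ :=
  GRing.isLinear.Build C (tensor A B) (tensor A' B') *:%R tensor_map tensor_map_linear.
End TensorMap.

Section DirectLimit.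
Variables (C : numClosedFieldType) (T : nat -> starAlgType C).
Variable i : forall n, starHom (T n) (T n.+1).

(* dl_map x m is the image of x : T n in T m for n <= m, and a junk value for
   m < n. *)
Fixpoint dl_map n (x : T n) (m : nat) {struct m} : T m :=
  match @eqP _ n m with
  | ReflectT e => ecast k (T k) e x
  | ReflectF _ => match m return T m with
                  | 0 => 0
                  | k.+1 => i k (dl_map x k)
                  end
  end.

Lemma dl_map_id n (x : T n) : dl_map x n = x.
Proof. by case: n x => [|n] x /=; case: eqP => // e; rewrite eq_axiomK. Qed.

Lemma dl_mapS n (x : T n) m : (n <= m)%N -> dl_map x m.+1 = i m (dl_map x m).
Proof. by move=> le_nm /=; case: eqP => // e; rewrite e ltnn in le_nm. Qed.

Lemma dl_map_comp n (x : T n) m k :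
  (n <= m)%N -> (m <= k)%N -> dl_map (dl_map x m) k = dl_map x k.
Proof.
move=> nm; elim: k => [|k IHk].
  by rewrite leqn0 => /eqP m0; subst m; rewrite dl_map_id.
rewrite leq_eqVlt => /predU1P[<-|mk]; first by rewrite dl_map_id.
by rewrite !dl_mapS ?IHk // (leq_trans nm).
Qed.

Lemma dl_map_starHom n m : (n <= m)%N ->
  [/\ linear (fun x : T n => dl_map x m),
      monoid_morphism (fun x : T n => dl_map x m)
    & {morph (fun x : T n => dl_map x m) : x / star x}].
Proof.
elim: m => [|m IHm].
  rewrite leqn0 => /eqP n0; subst n.
  split=> [k x y|| x]; last by rewrite !dl_map_id.
    by rewrite !dl_map_id.
  by split=> [|x y]; rewrite !dl_map_id.
rewrite leq_eqVlt => /predU1P[e|nm].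
  subst n; split=> [k x y|| x]; last by rewrite !dl_map_id.
    by rewrite !dl_map_id.
  by split=> [|x y]; rewrite !dl_map_id.
have [lin [one mul] st] := IHm nm.
split=> [k x y|| x]; last by rewrite !dl_mapS // st star_morph.
  by rewrite !dl_mapS // lin linearP.
by split=> [|x y]; rewrite !dl_mapS // ?one ?mul ?rmorph1 ?rmorphM.
Qed.

Definition dl_rel (x y : {n & T n}) : Prop :=
  exists k, [/\ (tag x <= k)%N, (tag y <= k)%N
              & dl_map (tagged x) k = dl_map (tagged y) k].

Definition dl_eq (x y : {n & T n}) : bool := `[< dl_rel x y >].

Fact dl_eq_refl : reflexive dl_eq.
Proof. by move=> x; apply/asboolP; exists (tag x). Qed.

Fact dl_eq_sym : symmetric dl_eq.
Proof. by move=> x y; apply/asboolP/asboolP => -[k [? ? ?]]; exists k. Qed.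

Fact dl_eq_trans : transitive dl_eq.
Proof.
move=> y x z /asboolP[k [xk yk exy]] /asboolP[l [yl zl eyz]].
apply/asboolP; exists (maxn k l); split.
- by rewrite leq_max xk.
- by rewrite leq_max zl orbT.
rewrite -(dl_map_comp _ xk) ?leq_maxl // exy dl_map_comp ?leq_maxl //.
by rewrite -(dl_map_comp _ yl) ?leq_maxr // eyz dl_map_comp ?leq_maxr.
Qed.

Canonical dl_equiv := EquivRel dl_eq dl_eq_refl dl_eq_sym dl_eq_trans.

Definition dlim : Type := {eq_quot dl_equiv}.
HB.instance Definition _ := Choice.on dlim.
HB.instance Definition _ := Quotient.on dlim.

Definition dl_in n (x : T n) : dlim := \pi_dlim (existT T n x).

Lemma dl_inP n (x : T n) m (y : T m) : dl_in x = dl_in y <->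
  exists k, [/\ (n <= k)%N, (m <= k)%N & dl_map x k = dl_map y k].
Proof.
split=> [/eqquotP/asboolP[k kP]|[k kP]]; first by exists k.
by apply/eqquotP/asboolP; exists k.
Qed.

Lemma dl_in_map n (x : T n) m : (n <= m)%N -> dl_in (dl_map x m) = dl_in x.
Proof. by move=> nm; apply/dl_inP; exists m; rewrite dl_map_id. Qed.

Lemma dlimW (x : dlim) : exists n (y : T n), x = dl_in y.
Proof.
by exists (tag (repr x)), (tagged (repr x)); rewrite /dl_in -[LHS]reprK; case: repr.
Qed.

Lemma dlim2W (x y : dlim) :
  exists n (x' y' : T n), x = dl_in x' /\ y = dl_in y'.
Proof.
have [n [x' ->]] := dlimW x; have [m [y' ->]] := dlimW y.
exists (maxn n m), (dl_map x' (maxn n m)), (dl_map y' (maxn n m)).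
by rewrite !dl_in_map ?leq_maxl ?leq_maxr.
Qed.

Lemma dlim3W (x y z : dlim) : exists n (x' y' z' : T n),
  [/\ x = dl_in x', y = dl_in y' & z = dl_in z'].
Proof.
have [n [x' [y' [-> ->]]]] := dlim2W x y; have [m [z' ->]] := dlimW z.
exists (maxn n m), (dl_map x' (maxn n m)), (dl_map y' (maxn n m)),
  (dl_map z' (maxn n m)).
by rewrite !dl_in_map ?leq_maxl ?leq_maxr.
Qed.

Lemma dl_in_repr n (x : T n) : let y := repr (dl_in x) in
  exists k, [/\ (tag y <= k)%N, (n <= k)%N & dl_map (tagged y) k = dl_map x k].
Proof.
move=> y; apply/dl_inP; rewrite /y /dl_in -[RHS]reprK.
by case: (repr (\pi_dlim (existT T n x))).
Qed.

Definition dl_lift1 (V : Type) (f : forall n, T n -> V) (x : dlim) : V :=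
  f (tag (repr x)) (tagged (repr x)).

Lemma dl_lift1E (V : Type) (f : forall n, T n -> V) :
  (forall n x, f n.+1 (i n x) = f n x) ->
  forall n (x : T n), dl_lift1 f (dl_in x) = f n x.
Proof.
move=> fi n x; have fmap m (y : T m) k : (m <= k)%N -> f k (dl_map y k) = f m y.
  elim: k => [|k IHk].
    by rewrite leqn0 => /eqP m0; subst m; rewrite dl_map_id.
  rewrite leq_eqVlt => /predU1P[<-|mk]; first by rewrite dl_map_id.
  by rewrite dl_mapS // fi IHk.
have [k [le1 le2 e]] := dl_in_repr x.
by rewrite /dl_lift1 -(fmap _ _ _ le1) e fmap.
Qed.

Definition dl_op2 (op : forall n, T n -> T n -> T n) (x y : dlim) : dlim :=
  let k := maxn (tag (repr x)) (tag (repr y)) in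
  dl_in (op k (dl_map (tagged (repr x)) k) (dl_map (tagged (repr y)) k)).

Lemma dl_op2E (op : forall n, T n -> T n -> T n) :
  (forall n m (x y : T n), (n <= m)%N ->
     dl_map (op n x y) m = op m (dl_map x m) (dl_map y m)) ->
  forall n (x y : T n), dl_op2 op (dl_in x) (dl_in y) = dl_in (op n x y).
Proof.
move=> opP n x y; rewrite /dl_op2.
have [a [xa na ea]] := dl_in_repr x; have [b [yb nb eb]] := dl_in_repr y.
set x' := repr (dl_in x) in xa ea *; set y' := repr (dl_in y) in yb eb *.
set k := maxn _ _.
have [xk yk] : (tag x' <= k)%N /\ (tag y' <= k)%N.
  by split; [exact: leq_maxl|exact: leq_maxr].
pose N := maxn k (maxn a b).
have [kN aN bN] : [/\ (k <= N)%N, (a <= N)%N & (b <= N)%N].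
  split; first exact: leq_maxl.
    exact: leq_trans (leq_maxl a b) (leq_maxr k _).
  exact: leq_trans (leq_maxr a b) (leq_maxr k _).
apply/dl_inP; exists N; split=> //; first exact: leq_trans na aN.
rewrite !opP // ?(leq_trans na aN) // !dl_map_comp //.
by rewrite -(dl_map_comp _ xa aN) ea -(dl_map_comp _ yb bN) eb !dl_map_comp.
Qed.

Definition dl_zero : dlim := dl_in (0 : T 0).
Definition dl_one : dlim := dl_in (1 : T 0).
Definition dl_add : dlim -> dlim -> dlim := dl_op2 (fun n => +%R).
Definition dl_mul : dlim -> dlim -> dlim := dl_op2 (fun n => *%R).
Definition dl_opp : dlim -> dlim := dl_lift1 (fun n (x : T n) => dl_in (- x)).
Definition dl_scale (k : C) : dlim -> dlim :=
  dl_lift1 (fun n (x : T n) => dl_in (k *: x)).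
Definition dl_star : dlim -> dlim :=
  dl_lift1 (fun n (x : T n) => dl_in (star x)).

Lemma dl_in_step n (x : T n) : dl_in (i n x) = dl_in x.
Proof. by rewrite -(dl_in_map x (leqnSn n)) dl_mapS // dl_map_id. Qed.

Lemma dl_addE n (x y : T n) : dl_add (dl_in x) (dl_in y) = dl_in (x + y).
Proof.
apply: (dl_op2E (op := fun n => +%R)) => {x y}m k x y mk.
by have [lin _ _] := dl_map_starHom mk; rewrite -[x]scale1r lin !scale1r.
Qed.

Lemma dl_mulE n (x y : T n) : dl_mul (dl_in x) (dl_in y) = dl_in (x * y).
Proof.
apply: (dl_op2E (op := fun n => *%R)) => {x y}m k x y mk.
by have [_ [_ mul] _] := dl_map_starHom mk; rewrite mul.
Qed.

Lemma dl_oppE n (x : T n) : dl_opp (dl_in x) = dl_in (- x).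
Proof.
apply: (dl_lift1E (f := fun n (x : T n) => dl_in (- x))) => {x}m x.
by rewrite -linearN dl_in_step.
Qed.

Lemma dl_scaleE k n (x : T n) : dl_scale k (dl_in x) = dl_in (k *: x).
Proof.
apply: (dl_lift1E (f := fun n (x : T n) => dl_in (k *: x))) => {x}m x.
by rewrite -linearZ dl_in_step.
Qed.

Lemma dl_starE n (x : T n) : dl_star (dl_in x) = dl_in (star x).
Proof.
apply: (dl_lift1E (f := fun n (x : T n) => dl_in (star x))) => {x}m x.
by rewrite -star_morph dl_in_step.
Qed.

Lemma dl_in0 n : dl_in (0 : T n) = dl_zero.
Proof.
have [lin _ _] := dl_map_starHom (leq0n n).
rewrite /dl_zero -(dl_in_map 0 (leq0n n)); congr dl_in.
by have := lin (-1) 0 0; rewrite scaler0 add0r scaleN1r addNr.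
Qed.

Lemma dl_in1 n : dl_in (1 : T n) = dl_one.
Proof.
have [_ [one _] _] := dl_map_starHom (leq0n n).
by rewrite /dl_one -(dl_in_map 1 (leq0n n)) one.
Qed.

Fact dl_addA : associative dl_add.
Proof.
move=> x y z; have [n [x' [y' [z' [-> -> ->]]]]] := dlim3W x y z.
by rewrite !dl_addE addrA.
Qed.

Fact dl_addC : commutative dl_add.
Proof.
move=> x y; have [n [x' [y' [-> ->]]]] := dlim2W x y.
by rewrite !dl_addE addrC.
Qed.

Fact dl_add0 : left_id dl_zero dl_add.
Proof.
by move=> x; have [n [x' ->]] := dlimW x; rewrite -(dl_in0 n) dl_addE add0r.
Qed.

Fact dl_addN : left_inverse dl_zero dl_opp dl_add.
Proof.
move=> x; have [n [x' ->]] := dlimW x.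
by rewrite dl_oppE dl_addE addNr dl_in0.
Qed.

HB.instance Definition _ := GRing.isZmodule.Build dlim
  dl_addA dl_addC dl_add0 dl_addN.

Lemma dl_inD n (x y : T n) : dl_in (x + y) = dl_in x + dl_in y.
Proof. by rewrite -dl_addE. Qed.

Fact dl_scaleA h k v : dl_scale h (dl_scale k v) = dl_scale (h * k) v.
Proof.
by have [n [x ->]] := dlimW v; rewrite !dl_scaleE scalerA.
Qed.

Fact dl_scale1 : left_id 1 dl_scale.
Proof. by move=> v; have [n [x ->]] := dlimW v; rewrite dl_scaleE scale1r. Qed.

Fact dl_scaleDr : right_distributive dl_scale +%R.
Proof.
move=> k x y; have [n [x' [y' [-> ->]]]] := dlim2W x y.
by rewrite -dl_inD !dl_scaleE scalerDr dl_inD.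
Qed.

Fact dl_scaleDl v : {morph dl_scale^~ v : h k / h + k}.
Proof.
move=> h k; have [n [x ->]] := dlimW v.
by rewrite !dl_scaleE scalerDl dl_inD.
Qed.

HB.instance Definition _ := GRing.Zmodule_isLmodule.Build C dlim
  dl_scaleA dl_scale1 dl_scaleDr dl_scaleDl.

Fact dl_mulA : associative dl_mul.
Proof.
move=> x y z; have [n [x' [y' [z' [-> -> ->]]]]] := dlim3W x y z.
by rewrite !dl_mulE mulrA.
Qed.

Fact dl_mul1l : left_id dl_one dl_mul.
Proof.
by move=> x; have [n [x' ->]] := dlimW x; rewrite -(dl_in1 n) dl_mulE mul1r.
Qed.

Fact dl_mul1r : right_id dl_one dl_mul.
Proof.
by move=> x; have [n [x' ->]] := dlimW x; rewrite -(dl_in1 n) dl_mulE mulr1.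
Qed.

Fact dl_mulDl : left_distributive dl_mul +%R.
Proof.
move=> x y z; have [n [x' [y' [z' [-> -> ->]]]]] := dlim3W x y z.
by rewrite -dl_inD !dl_mulE mulrDl dl_inD.
Qed.

Fact dl_mulDr : right_distributive dl_mul +%R.
Proof.
move=> x y z; have [n [x' [y' [z' [-> -> ->]]]]] := dlim3W x y z.
by rewrite -dl_inD !dl_mulE mulrDr dl_inD.
Qed.

Fact dl_one_neq0 : dl_one != 0.
Proof.
apply/eqP => /dl_inP[k [k0 _]].
have [lin [-> _] _] := dl_map_starHom k0.
have := lin (-1) 0 0; rewrite scaler0 add0r scaleN1r addNr => -> /eqP.
by rewrite oner_eq0.
Qed.

HB.instance Definition _ := GRing.Zmodule_isNzRing.Build dlim
  dl_mulA dl_mul1l dl_mul1r dl_mulDl dl_mulDr dl_one_neq0.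

Lemma dl_inM n (x y : T n) : dl_in (x * y) = dl_in x * dl_in y.
Proof. by rewrite -dl_mulE. Qed.

Lemma dl_inZ k n (x : T n) : dl_in (k *: x) = k *: dl_in x.
Proof. by rewrite -dl_scaleE. Qed.

Fact dl_scalerAl (k : C) (x y : dlim) : k *: (x * y) = (k *: x) * y.
Proof.
have [n [x' [y' [-> ->]]]] := dlim2W x y.
by rewrite -dl_inM -!dl_inZ -dl_inM scalerAl.
Qed.

Fact dl_scalerAr (k : C) (x y : dlim) : k *: (x * y) = x * (k *: y).
Proof.
have [n [x' [y' [-> ->]]]] := dlim2W x y.
by rewrite -dl_inM -!dl_inZ -dl_inM scalerAr.
Qed.

HB.instance Definition _ := GRing.Lmodule_isLalgebra.Build C dlim dl_scalerAl.
HB.instance Definition _ := GRing.Lalgebra_isAlgebra.Build C dlim dl_scalerAr.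

Fact dl_starK : involutive dl_star.
Proof. by move=> x; have [n [x' ->]] := dlimW x; rewrite !dl_starE starK. Qed.

Fact dl_starD : {morph dl_star : x y / x + y}.
Proof.
move=> x y; have [n [x' [y' [-> ->]]]] := dlim2W x y.
by rewrite -dl_inD !dl_starE starD dl_inD.
Qed.

Fact dl_starM (x y : dlim) : dl_star (x * y) = dl_star y * dl_star x.
Proof.
have [n [x' [y' [-> ->]]]] := dlim2W x y.
by rewrite -dl_inM !dl_starE starM dl_inM.
Qed.

Fact dl_starZ (k : C) (x : dlim) : dl_star (k *: x) = k^* *: dl_star x.
Proof.
have [n [x' ->]] := dlimW x.
by rewrite -dl_inZ !dl_starE starZ dl_inZ.
Qed.

HB.instance Definition _ := isStarAlgebra.Build C dlim
  dl_starK dl_starD dl_starM dl_starZ.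

Fact dl_in_linear n : linear (@dl_in n).
Proof. by move=> k x y; rewrite dl_inD dl_inZ. Qed.
Fact dl_in_monoid n : monoid_morphism (@dl_in n).
Proof. by split=> [|x y]; rewrite ?dl_in1 ?dl_inM. Qed.
Fact dl_in_star n : {morph @dl_in n : x / star x}.
Proof. by move=> x; rewrite -dl_starE. Qed.
HB.instance Definition _ n :=
  GRing.isLinear.Build C (T n) dlim *:%R (@dl_in n) (@dl_in_linear n).
HB.instance Definition _ n :=
  GRing.isMonoidMorphism.Build (T n) dlim (@dl_in n) (@dl_in_monoid n).
HB.instance Definition _ n :=
  isStarMorphism.Build C (T n) dlim (@dl_in n) (@dl_in_star n).

Lemma dl_lift1_linear (V : lmodType C) (f : forall n, {linear T n -> V}) :
  (forall n x, f n.+1 (i n x) = f n x) -> linear (dl_lift1 (fun n => f n)).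
Proof.
move=> fi k x y; have [n [x' [y' [-> ->]]]] := dlim2W x y.
by rewrite -dl_inZ -dl_inD !(dl_lift1E (f := fun n => f n)) // linearP.
Qed.

End DirectLimit.

Section InfiniteTensor.
Variables (C : numClosedFieldType) (B : nat -> starAlgType C).

Fixpoint ftensor (n : nat) : starAlgType C :=
  match n with
  | 0 => B 0
  | k.+1 => (ftensor k ⊗ B k.+1)%type
  end.

Definition ftensor_step (n : nat) : starHom (ftensor n) (ftensor n.+1) :=
  @tens_l C (ftensor n) (B n.+1).

(* The infinite tensor product is the union of the finite ones B 0 ⊗ ... ⊗ B n,
   where x in the n-th one is identified with x ⊗ 1 in the next one. *)
Definition itensor : starAlgType C := dlim ftensor_step.

Definition tensor_in (n : nat) : starHom (ftensor n) itensor :=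
  @dl_in C ftensor ftensor_step n.

Definition ftensor_last (n : nat) : starHom (B n) (ftensor n) :=
  match n return starHom (B n) (ftensor n) with
  | 0 => @idfun (B 0)
  | k.+1 => @tens_r C (ftensor k) (B k.+1)
  end.

Definition tensor_embedding (n : nat) : starHom (B n) itensor :=
  tensor_in n \o ftensor_last n.

End InfiniteTensor.

Definition positive_mx (C : numClosedFieldType) (A : starAlgType C) (k : nat)
    (M : 'M[A]_k) : Prop :=
  exists (m : nat) (c : 'I_m -> 'I_k -> A),
    M = \sum_(l < m) \matrix_(p, q) (star (c l p) * c l q).

Definition completely_positive (C : numClosedFieldType) (A B : starAlgType C)
    (f : A -> B) : Prop :=
  forall (k : nat) (a : 'I_k -> A),
    positive_mx (\matrix_(p, q) f (star (a p) * a q)).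

Record emission (C : numClosedFieldType) (A B : starAlgType C) := Emission {
  emission_map :> {linear A -> B};
  emission_cp : completely_positive emission_map;
  emission1 : emission_map 1 = 1
}.

Arguments emission {C} (A B)%_type_scope.

Section GlobalEmission.
Variables (C : numClosedFieldType) (A B : nat -> starAlgType C).
Variable E : forall n, emission (A n) (B n).

Fixpoint ftensor_map (n : nat) : {linear ftensor A n -> ftensor B n} :=
  match n return {linear ftensor A n -> ftensor B n} with
  | 0 => E 0
  | k.+1 => tensor_map (ftensor_map k) (E k.+1)
  end.

(* On the n-th finite tensor product this is E 0 ⊗ ... ⊗ E n; the choice of n
   is immaterial because E n.+1 maps 1 to 1 (see global_emission_in). *)
Definition global_emission : itensor A -> itensor B :=
  dl_lift1 (fun n x => tensor_in B n (ftensor_map n x)).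

Lemma global_emission_in n (x : ftensor A n) :
  global_emission (tensor_in A n x) = tensor_in B n (ftensor_map n x).
Proof.
apply: (dl_lift1E (f := fun n x => tensor_in B n (ftensor_map n x))) => {x}m x.
rewrite /= /tens_l tensor_mapE emission1.
exact: dl_in_step.
Qed.

Fact global_emission_linear : linear global_emission.
Proof.
apply: (dl_lift1_linear (f := fun n => tensor_in B n \o ftensor_map n)) => m x.
rewrite /= /tens_l tensor_mapE emission1.
exact: dl_in_step.
Qed.

HB.instance Definition _ :=
  GRing.isLinear.Build C (itensor A) (itensor B) *:%R global_emission global_emission_linear.

End GlobalEmission.

Record state (C : numClosedFieldType) (A : starAlgType C) := State {
  state_map :> {scalar A};
  state_ge0 : forall a : A, 0 <= state_map (star a * a);
  state1 : state_map 1 = 1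
}.

Record qprocess (C : numClosedFieldType) (B : nat -> starAlgType C) := QProcess {
  sample_algebra : starAlgType C;
  process_state : state sample_algebra;
  process_hom : forall n, starHom (B n) sample_algebra
}.

(* The joint expectations are the values of the state on the ordered products
   j_(n_1)(b_1) ... j_(n_k)(b_k), where the indices n_1, ..., n_k are arbitrary
   and may repeat. *)
Definition joint_expectation (C : numClosedFieldType) (B : nat -> starAlgType C)
    (Q : qprocess B) (s : seq {n & B n}) : C :=
  process_state Q (\prod_(b <- s) process_hom Q (tag b) (tagged b)).

Definition stochastically_equivalent (C : numClosedFieldType)
    (B : nat -> starAlgType C) (Q Q' : qprocess B) : Prop :=
  forall s, joint_expectation Q s = joint_expectation Q' s.

Definition tensor_process (C : numClosedFieldType) (B : nat -> starAlgType C)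
    (P : state (itensor B)) : qprocess B :=
  QProcess P (tensor_embedding B).

(* Main.v *)
Require Import Defs.
From mathcomp Require Import all_boot all_order all_algebra.
From mathcomp Require Import reals complex.

Set Implicit Arguments.
Unset Strict Implicit.
Unset Printing Implicit Defensive.

Import Order.TTheory GRing.Theory Num.Theory.
Local Open Scope ring_scope.

(* The map [P_H \o E] is a state because a tensor product of completely positive
   maps is completely positive: if [z_p = \sum_s a_ps ⊗ b_ps], then the matrix
   [(f ⊗ g) (z_p^* z_q)] is obtained from the entrywise tensor product of the
   positive matrices [f (a_ps^* a_qt)] and [g (b_ps^* b_qt)], indexed by pairs,
   by summing over [s] and [t]; both operations preserve positivity. It is
   determined by the product formula because the products of the elements
   [j_m (g_m ⊗ f_m)] span the algebra. *)

Section CompletelyPositive.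
Variables (C : numClosedFieldType).

(** Positivity with arbitrary finite index types, so that a matrix may be indexed directly by pairs
    such as ['I_k * 'I_N]. *)
Definition gram (A : starAlgType C) (I : finType) (M : I -> I -> A) : Prop :=
  exists (J : finType) (c : J -> I -> A),
    forall p q, M p q = \sum_(l : J) star (c l p) * c l q.

Lemma positive_mx_gram (A : starAlgType C) k (M : 'M[A]_k) :
  positive_mx M <-> gram M.
Proof.
split=> [[m [c ->]]|[J [c cM]]].
  exists 'I_m, c => p q; rewrite summxE.
  by apply: eq_bigr => l _; rewrite mxE.
exists #|J|, (fun l => c (enum_val l)); apply/matrixP => p q.
rewrite cM summxE (big_enum_val (A := J) (fun l => star (c l p) * c l q)).
by apply: eq_bigr => l _; rewrite mxE.
Qed.

Lemma completely_positive_gram (A B : starAlgType C) (f : A -> B) :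
  completely_positive f ->
  forall (I : finType) (a : I -> A), gram (fun p q => f (star (a p) * a q)).
Proof.
move=> fcp I a.
have /positive_mx_gram[J [c cP]] := fcp #|I| (fun p => a (enum_val p)).
exists J, (fun l p => c l (enum_rank p)) => p q.
by rewrite -cP mxE !enum_rankK.
Qed.

Lemma star0 (A : starAlgType C) : star 0 = 0 :> A.
Proof. by rewrite -[X in star X](scale0r (0 : A)) starZ conjC0 scale0r. Qed.

Lemma star_sum (A : starAlgType C) (I : Type) (r : seq I) (P : pred I) (F : I -> A) :
  star (\sum_(i <- r | P i) F i) = \sum_(i <- r | P i) star (F i).
Proof. exact: (big_morph _ (@starD _ A) (@star0 A)). Qed.

Lemma tens_suml (A B : starAlgType C) (I : Type) (r : seq I) (F : I -> A) (b : B) :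
  (\sum_(i <- r) F i) ⊗ b = \sum_(i <- r) F i ⊗ b.
Proof.
by apply: (big_morph (fun a => a ⊗ b)) => [x y|]; rewrite ?tensDl ?tens0l.
Qed.

Lemma tens_sumr (A B : starAlgType C) (I : Type) (r : seq I) (a : A) (F : I -> B) :
  a ⊗ (\sum_(i <- r) F i) = \sum_(i <- r) a ⊗ F i.
Proof.
by apply: (big_morph (fun b => a ⊗ b)) => [x y|]; rewrite ?tensDr ?tens0r.
Qed.

(** Shorter representatives are padded with zero tensors, so that the pairs [(p, s)] of an element
    and a summand form a product of finite types. *)
Lemma tensor_common_length (A B : starAlgType C) (I : finType) (z : I -> tensor A B) :
  exists (N : nat) (a : I -> 'I_N -> A) (b : I -> 'I_N -> B),
    forall p, z p = \sum_(s < N) a p s ⊗ b p s.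
Proof.
pose s p : seq (A * B) := repr (z p); pose N := \max_p size (s p).
exists N, (fun p i => (nth (0, 0) (s p) i).1), (fun p i => (nth (0, 0) (s p) i).2).
move=> p; rewrite -[LHS]reprK pi_tens_sum -/(s p).
have sN : (size (s p) <= N)%N by apply: (leq_bigmax p).
rewrite (big_nth (0, 0)) (big_nat_widen _ _ N) // big_mkord.
rewrite [RHS](bigID (fun i : 'I_N => i < size (s p))%N) /= [X in _ + X]big1 ?addr0 //.
by move=> i; rewrite -leqNgt => /(nth_default (0, 0)) ->; rewrite tens0l.
Qed.

Lemma tensor_map_cp (A A' B B' : starAlgType C)
    (f : {linear A -> A'}) (g : {linear B -> B'}) :
  completely_positive f -> completely_positive g ->
  completely_positive (tensor_map f g).
Proof.
move=> /completely_positive_gram fcp /completely_positive_gram gcp k z.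
have [N [a [b zE]]] := tensor_common_length z.
have [J [c cP]] := fcp ('I_k * 'I_N)%type (fun i => a i.1 i.2).
have [L [d dP]] := gcp ('I_k * 'I_N)%type (fun i => b i.1 i.2).
apply/positive_mx_gram.
(* These are the tensor products of the two families of square roots, summed over the summand index
   [s]; expanding the squares bilinearly recovers every term in [s] and [t]. *)
exists (J * L)%type, (fun l p => \sum_(s < N) c l.1 (p, s) ⊗ d l.2 (p, s)) => p q.
rewrite mxE !zE star_sum mulr_suml linear_sum /=.
under [RHS]eq_bigr => l _ do rewrite star_sum mulr_suml.
rewrite [RHS]exchange_big /=; apply: eq_bigr => s _.
rewrite mulr_sumr linear_sum /=.
under [RHS]eq_bigr => l _ do rewrite mulr_sumr.
rewrite [RHS]exchange_big /=; apply: eq_bigr => t _.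
rewrite star_tens tensM tensor_mapE (cP (p, s) (q, t)) (dP (p, s) (q, t)).
rewrite tens_suml -(pair_bigA _ (fun j l =>
  star (c j (p, s) ⊗ d l (p, s)) * (c j (q, t) ⊗ d l (q, t)))) /=.
apply: eq_bigr => j _; rewrite tens_sumr; apply: eq_bigr => l _.
by rewrite star_tens tensM.
Qed.

End CompletelyPositive.

Section GlobalEmissionTheory.
Variables (C : numClosedFieldType) (A B : nat -> starAlgType C).
Variable E : forall n, emission (A n) (B n).

Lemma ftensor_map_cp n : completely_positive (ftensor_map E n).
Proof.
elim: n => [|n IHn]; first exact: emission_cp.
exact/tensor_map_cp/emission_cp.
Qed.

Lemma global_emission1 : global_emission E 1 = 1.
Proof.
have -> : (1 : itensor A) = tensor_in A 0 1 by rewrite rmorph1.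
by rewrite global_emission_in /= emission1 rmorph1.
Qed.

(** Every element comes from a finite stage, where complete positivity applied to a single element
    turns [star y * y] into a sum of squares. *)
Lemma global_emission_ge0 (P : state (itensor B)) (x : itensor A) :
  0 <= P (global_emission E (star x * x)).
Proof.
have [n [y ->]] := dlimW x.
have [J [c cP]] :=
  completely_positive_gram (@ftensor_map_cp n) (fun _ : 'I_1 => y).
rewrite -dl_in_star -dl_inM (global_emission_in E) (cP ord0 ord0) !linear_sum.
apply: sumr_ge0 => l _; by rewrite rmorphM /= star_morph state_ge0.
Qed.

Lemma comp_global_emission1 (P : state (itensor B)) :
  (P \o global_emission E) 1 = 1.
Proof. by rewrite /= global_emission1 state1. Qed.

Definition pullback_state (P : state (itensor B)) : state (itensor A) :=
  @State _ _ (P \o global_emission E)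
    (global_emission_ge0 P) (comp_global_emission1 P).

End GlobalEmissionTheory.

Section PureTensors.
Variables (C : numClosedFieldType).

(** Taking a family over all indices avoids dependent tuples; [eq_pure_tensor] records that only the
    entries up to [n] matter. *)
Fixpoint pure_tensor (B : nat -> starAlgType C) (x : forall m, B m) n :
    ftensor B n :=
  match n with
  | 0 => x 0
  | k.+1 => pure_tensor x k ⊗ x k.+1
  end.

Lemma prod_tensor_embedding (B : nat -> starAlgType C) (x : forall m, B m) n :
  \prod_(m < n.+1) tensor_embedding B m (x m) = tensor_in B n (pure_tensor x n).
Proof.
elim: n => [|n IHn]; first by rewrite big_ord1.
(* The first [n.+1] factors are moved up one stage as [X ⊗ 1], and [(X ⊗ 1) * (1 ⊗ x) = X ⊗ x]. *)
rewrite big_ord_recr /= IHn -[X in X * _]dl_in_step -dl_inM.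
by rewrite /= tensM mulr1 mul1r.
Qed.

Lemma ftensor_map_pure (A B : nat -> starAlgType C)
    (E : forall n, emission (A n) (B n)) (x : forall m, A m) n :
  ftensor_map E n (pure_tensor x n) = pure_tensor (fun m => E m (x m)) n.
Proof. by elim: n => //= n IHn; rewrite tensor_mapE IHn. Qed.

Lemma eq_pure_tensor (B : nat -> starAlgType C) (x y : forall m, B m) n :
  (forall m, (m <= n)%N -> x m = y m) -> pure_tensor x n = pure_tensor y n.
Proof.
elim: n => [|n IHn] xy /=; first exact: xy.
by rewrite xy // IHn // => m mn; apply: xy; apply: leqW.
Qed.

(** By induction on the stage, then on each of the two tensor factors: scalars can be absorbed into
    a factor, so elementary tensors span additively. *)
Lemma ftensor_ind (A B : nat -> starAlgType C) n
    (K : ftensor (fun m => (A m ⊗ B m)%type) n -> Prop) :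
  (forall a b, K (pure_tensor (fun m => a m ⊗ b m) n)) ->
  K 0 -> (forall x y, K x -> K y -> K (x + y)) -> forall x, K x.
Proof.
elim: n K => [|n IHn] K Kpure K0 KD.
  apply: tensor_ind => // a b.
  (* Only the entry at [0] is read at this stage; the zeros elsewhere are fillers. *)
  have := Kpure (dfwith (fun m => 0 : A m) a) (dfwith (fun m => 0 : B m) b).
  by rewrite /= !dfwith_in.
apply: tensor_ind => // x y; move: x.
apply: IHn => [a b||x x' Kx Kx']; last by rewrite tensDl; apply: KD.
  elim/tensor_ind: y => [c d||y y' Ky Ky']; last by rewrite tensDr; apply: KD.
    (* The families are overridden at [n.+1] by the new factor, which leaves the pure tensor of
       stage [n] unchanged. *)
    have := Kpure (dfwith a c) (dfwith b d); rewrite /= !dfwith_in.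
    congr (K (_ ⊗ _)); apply: eq_pure_tensor => m mn.
    by rewrite !dfwith_out // neq_ltn ltnS mn orbT.
  by rewrite tens0r.
by rewrite tens0l.
Qed.

Lemma eq_scalar_itensor (A B : nat -> starAlgType C)
    (phi psi : {scalar itensor (fun m => (A m ⊗ B m)%type)}) :
  (forall n (a : forall m, A m) (b : forall m, B m),
    let x := \prod_(m < n.+1)
      tensor_embedding (fun m => (A m ⊗ B m)%type) m (a m ⊗ b m) in
    phi x = psi x) ->
  phi =1 psi.
Proof.
move=> eq_prod x; have [n [y ->]] := dlimW x.
elim/ftensor_ind: y => [a b||y y' IH IH'].
- have := eq_prod n a b.
  by rewrite /= (prod_tensor_embedding (fun m => a m ⊗ b m : (A m ⊗ B m)%type)).
- by rewrite !linear0.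
- by rewrite !linearD /= IH IH'.
Qed.

End PureTensors.

Theorem theorem8 (R : realType) (BH BO : nat -> starAlgType R[i])
    (PH : state (itensor BH))
    (E : forall n : nat, emission (BH n ⊗ BO n) (BH n)) :
  let BHO : nat -> starAlgType R[i] := fun n => (BH n ⊗ BO n)%type in
  let H : qprocess BH := tensor_process PH in
  let is_emission_process (Q : qprocess BHO) : Prop :=
    forall (n : nat) (g : forall m, BH m) (f : forall m, BO m),
      process_state Q (\prod_(m < n.+1) process_hom Q m (g m ⊗ f m)) =
      process_state H (\prod_(m < n.+1) process_hom H m (E m (g m ⊗ f m))) in
  exists PHO : state (itensor BHO),
    [/\ forall x : itensor BHO, PHO x = PH (global_emission E x),
        is_emission_process (tensor_process PHO)
      & forall PHO' : state (itensor BHO),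
          is_emission_process (tensor_process PHO') ->
          stochastically_equivalent (tensor_process PHO) (tensor_process PHO')].
Proof.
move=> BHO H is_emission_process.
have PHO_emission : is_emission_process (tensor_process (pullback_state E PH)).
  move=> n g f /=.
  rewrite (prod_tensor_embedding (fun m => g m ⊗ f m : BHO m)).
  rewrite (prod_tensor_embedding (fun m => E m (g m ⊗ f m))).
  by rewrite global_emission_in ftensor_map_pure.
exists (pullback_state E PH); split=> // PHO' PHO'_emission s.
(* The two states agree on the whole algebra, hence on any word [s], even one with repeated or
   unordered indices. *)
apply: eq_scalar_itensor => n g f.
exact: etrans (PHO_emission n g f) (esym (PHO'_emission n g f)).
Qed.
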